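(* Let $\lambda\in\mathbb{R}$ and $r\in\mathbb{N}\cup\{0\}$. For every integer $n\ge0$, the following identities hold (as polynomials in the variable $x$): $$Bel_{n,\lambda}^{(r)}(x)=\sum_{k=0}^{n}x^k\,S_{2,r}(n+r,k+r|\lambda)=\sum_{k=0}^{n}\left(\sum_{m=k}^{n}\sum_{l=0}^{n-m}r^l\,\lambda^{n-m-l}\,S_1(n-m,l)\,S_{2,\lambda}(m,k)\binom{n}{m}\right)x^k.$$
   Context: All generating functions are formal power series in $t$. For a number $y$, $(1+\lambda t)^{y/\lambda}$ denotes the formal power series $\sum_{n\ge0}(y|\lambda)_n\frac{t^n}{n!}$, where $(y|\lambda)_0=1$ and $(y|\lambda)_n=y(y-\lambda)(y-2\lambda)\cdots(y-(n-1)\lambda)$ for $n\ge1$ (for $\lambda=0$ this is the limit $e^{yt}$). The convention $0^0=1$ is used. The (signed) Stirling numbers of the first kind $S_1(n,k)$ are defined by $(x)_n=\sum_{k=0}^n S_1(n,k)x^k$, where $(x)_0=1$ and $(x)_n=x(x-1)\cdots(x-n+1)$ for $n\ge1$. The degenerate Stirling numbers of the second kind $S_{2,\lambda}(n,k)$ are defined, for $k\ge0$, by $$\frac{1}{k!}\left((1+\lambda t)^{1/\lambda}-1\right)^k=\sum_{n=k}^\infty S_{2,\lambda}(n,k)\frac{t^n}{n!}.$$ The extended degenerate Stirling numbers of the second kind $S_{2,r}(n+r,k+r|\lambda)$ are defined, for $r,k\in\mathbb{N}\cup\{0\}$, by $$\frac{1}{k!}(1+\lambda t)^{r/\lambda}\left((1+\lambda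 t)^{1/\lambda}-1\right)^k=\sum_{n=k}^\infty S_{2,r}(n+r,k+r|\lambda)\frac{t^n}{n!}.$$ The extended degenerate Bell polynomials $Bel_{n,\lambda}^{(r)}(x)$ are defined by $$(1+\lambda t)^{r/\lambda}\,e^{x\left((1+\lambda t)^{1/\lambda}-1\right)}=\sum_{n=0}^\infty Bel_{n,\lambda}^{(r)}(x)\frac{t^n}{n!}.$$ *)

(* Defs.v *)
From HB Require Import structures.
From mathcomp Require Import all_boot all_order all_algebra.
From mathcomp Require Import boolp reals.

Set Implicit Arguments.
Unset Strict Implicit.
Unset Printing Implicit Defensive.

Import GRing.Theory.

Local Open Scope ring_scope.

(* The ring A[[t]]; [f n] is the coefficient of t^n (without the factor 1/n!). *)
Record fps (A : Type) := Fps { coef_fps :> nat -> A }.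

HB.instance Definition _ (A : Type) := gen_eqMixin (fps A).
HB.instance Definition _ (A : Type) := gen_choiceMixin (fps A).

Lemma fpsP (A : Type) (f g : fps A) : f =1 g -> f = g.
Proof. by case: f g => [f] [g] /= /funext ->. Qed.

Section FpsRing.
Variable A : comNzRingType.
Implicit Types f g h : fps A.

Definition fpsC (c : A) : fps A := Fps (fun n => if n is 0 then c else 0).
Definition fps_add f g : fps A := Fps (fun n => f n + g n).
Definition fps_opp f : fps A := Fps (fun n => - f n).
Definition fps_mul f g : fps A := Fps (fun n => \sum_(i < n.+1) f i * g (n - i)%N).

Fact fps_addA : associative fps_add.
Proof. by move=> f g h; apply: fpsP => n /=; rewrite addrA. Qed.

Fact fps_addC : commutative fps_add.
Proof. by move=> f g; apply: fpsP => n /=; rewrite addrC. Qed.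

Fact fps_add0 : left_id (fpsC 0) fps_add.
Proof. by move=> f; apply: fpsP => -[|n] /=; rewrite add0r. Qed.

Fact fps_addN : left_inverse (fpsC 0) fps_opp fps_add.
Proof. by move=> f; apply: fpsP => -[|n] /=; rewrite addNr. Qed.

HB.instance Definition _ :=
  GRing.isZmodule.Build (fps A) fps_addA fps_addC fps_add0 fps_addN.

Let trunc N f : {poly A} := \poly_(i < N) f i.

Let fps_mul_trunc N f g n : (n < N)%N ->
  fps_mul f g n = (trunc N f * trunc N g)`_n.
Proof.
move=> ltnN; rewrite coefM; apply: eq_bigr => i _; rewrite !coef_poly.
by rewrite (leq_ltn_trans (leq_ord i) ltnN) (leq_ltn_trans (leq_subr i n) ltnN).
Qed.

Let coefM_trunc N (p q p' q' : {poly A}) n : (n < N)%N ->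
  (forall i, (i < N)%N -> p`_i = p'`_i) ->
  (forall i, (i < N)%N -> q`_i = q'`_i) -> (p * q)`_n = (p' * q')`_n.
Proof.
move=> ltnN eqp eqq; rewrite !coefM; apply: eq_bigr => i _.
by rewrite eqp ?eqq ?(leq_ltn_trans (leq_subr i n)) ?(leq_ltn_trans (leq_ord i)).
Qed.

Fact fps_mulC : commutative fps_mul.
Proof.
by move=> f g; apply: fpsP => n; rewrite !(@fps_mul_trunc n.+1) // mulrC.
Qed.

Fact fps_mulA : associative fps_mul.
Proof.
move=> f g h; apply: fpsP => n; rewrite !(@fps_mul_trunc n.+1) //.
have tM u v i : (i < n.+1)%N ->
    (trunc n.+1 (fps_mul u v))`_i = (trunc n.+1 u * trunc n.+1 v)`_i.
  by move=> lti; rewrite coef_poly lti (fps_mul_trunc _ _ lti).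
rewrite (coefM_trunc (ltnSn n) (fun _ _ => erefl) (tM g h)) mulrA.
by rewrite (coefM_trunc (ltnSn n) (tM f g) (fun _ _ => erefl)).
Qed.

Fact fps_mul1 : left_id (fpsC 1) fps_mul.
Proof.
move=> f; apply: fpsP => n /=; rewrite big_ord_recl /= mul1r subn0.
by rewrite big1 ?addr0 // => i _; rewrite mul0r.
Qed.

Fact fps_mulDl : left_distributive fps_mul fps_add.
Proof.
move=> f g h; apply: fpsP => n /=; rewrite -big_split /=.
by apply: eq_bigr => i _; rewrite mulrDl.
Qed.

Fact fps_1neq0 : fpsC 1 != 0.
Proof. by apply/eqP => /(congr1 (fun f : fps A => f 0)) /eqP /=; rewrite oner_eq0. Qed.

HB.instance Definition _ := GRing.Zmodule_isComNzRing.Build (fps A)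
  fps_mulA fps_mulC fps_mul1 fps_mulDl fps_1neq0.

End FpsRing.

Definition fps_map (A B : Type) (phi : A -> B) (f : fps A) : fps B :=
  Fps (fun n => phi (f n)).

(* The coefficient of t^n/n! in f. *)
Definition egf_coef (A : comNzRingType) (f : fps A) (n : nat) : A :=
  n`!%:R * f n.

(* (y|lam)_n = y (y - lam) ... (y - (n-1) lam) *)
Definition deg_ffact (R : realType) (lam y : R) (n : nat) : R :=
  \prod_(i < n) (y - i%:R * lam).

(* (1 + lam t)^(y/lam); for lam = 0 this is e^(yt). *)
Definition deg_exp (R : realType) (lam y : R) : fps R :=
  Fps (fun n => deg_ffact lam y n / n`!%:R).

(* e^F = \sum_k F^k/k! in R[x][[t]], for F with zero constant term: then only
   the k <= n contribute to the coefficient of t^n. *)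
Definition fps_exp (R : realType) (F : fps {poly R}) : fps {poly R} :=
  Fps (fun n => \sum_(k < n.+1) (k`!%:R^-1 : R) *: (F ^+ k) n).

(* Signed Stirling number of the first kind: the coefficient of x^k in
   x (x - 1) ... (x - n + 1). *)
Definition stirling1 (n k : nat) : int :=
  (\prod_(i < n) ('X - (i%:Z)%:P) : {poly int})`_k.

(* S_{2,lam}(n, k) *)
Definition deg_stirling2 (R : realType) (lam : R) (n k : nat) : R :=
  egf_coef (fpsC k`!%:R^-1 * (deg_exp lam 1 - 1) ^+ k) n.

(* S_{2,r}(N, K | lam), meaningful for N, K >= r only: the generating function
   in the variable t defines S_{2,r}(n + r, k + r | lam), so N = n + r and
   K = k + r. *)
Definition ext_deg_stirling2 (R : realType) (lam : R) (r N K : nat) : R :=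
  let n := (N - r)%N in
  let k := (K - r)%N in
  egf_coef (fpsC k`!%:R^-1 * deg_exp lam r%:R * (deg_exp lam 1 - 1) ^+ k) n.

(* Bel_{n,lam}^{(r)}(x), a polynomial in x = 'X; its generating function lives
   in R[x][[t]]. *)
Definition ext_deg_bell (R : realType) (lam : R) (r n : nat) : {poly R} :=
  egf_coef (fps_map polyC (deg_exp lam r%:R) *
            fps_exp (fpsC 'X * fps_map polyC (deg_exp lam 1 - 1))) n.

(* Main.v *)
Require Import Defs.
From mathcomp Require Import all_boot all_order all_algebra.
From mathcomp Require Import reals ring.

(** Multiplication of exponential generating functions is binomial convolution,
    so splitting off the factor [(1 + lam t)^(r/lam)], whose coefficients are the
    degenerate factorials [(r|lam)_n], expresses [S_{2,r}] through [S_{2,lam}].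
    The homogenized form [(y|lam)_n = \sum_l S_1(n,l) y^l lam^(n-l)] of the
    definition of [S_1] then gives the double sum. *)

Import GRing.Theory.

Local Open Scope ring_scope.

Section PowerSeries.
Variable A : comNzRingType.
Implicit Types f g : fps A.

Lemma coef_fpsM f g n : (f * g) n = \sum_(i < n.+1) f i * g (n - i)%N.
Proof. by []. Qed.

Lemma coef_fpsCM c f n : (fpsC c * f) n = c * f n.
Proof.
rewrite coef_fpsM big_ord_recl subn0 big1 ?addr0 // => i _.
by rewrite mul0r.
Qed.

Lemma fpsC_exp (c : A) k : fpsC c ^+ k = fpsC (c ^+ k).
Proof.
elim: k => [|k IHk]; first by rewrite !expr0.
rewrite !exprS IHk; apply: fpsP => n; rewrite coef_fpsCM.
by case: n => //= n; rewrite mulr0.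
Qed.

(** A series without constant term is divisible by $t$, so its $k$-th power is divisible by
    $t^k$. *)
Lemma coef_fpsX_small f n k : f 0%N = 0 -> (n < k)%N -> (f ^+ k) n = 0.
Proof.
move=> f0; elim: k n => // k IHk n; rewrite ltnS => le_nk.
rewrite exprS coef_fpsM big1 // => -[[|i] /= lt_in] _; first by rewrite f0 mul0r.
rewrite IHk ?mulr0 //; apply: leq_trans le_nk.
by rewrite ltn_subrL /=; case: n lt_in.
Qed.

Lemma fps_map_exp (B : comNzRingType) (phi : {rmorphism A -> B}) f k :
  fps_map phi (f ^+ k) = fps_map phi f ^+ k.
Proof.
elim: k => [|k IHk].
  by rewrite !expr0; apply: fpsP => -[|n] /=; rewrite ?rmorph1 ?rmorph0.
rewrite !exprS -IHk; apply: fpsP => n.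
rewrite /= rmorph_sum; apply: eq_bigr => i _.
by rewrite rmorphM.
Qed.

Lemma egf_coefM f g n :
  egf_coef (f * g) n =
    \sum_(m < n.+1) egf_coef f (n - m) * egf_coef g m * 'C(n, m)%:R.
Proof.
(* Swapping the factors makes the summation index [m] the degree taken from [g]. *)
rewrite /egf_coef mulrC [f * g]mulrC coef_fpsM mulr_suml.
apply: eq_bigr => m _; have le_mn : (m <= n)%N by rewrite -ltnS.
by rewrite -(bin_fact le_mn) !natrM; ring.
Qed.

End PowerSeries.

(** Compare coefficients after splitting off the last factor $x - n$ of the falling factorial. *)
Lemma stirling1S n k :
  stirling1 n.+1 k =
    (if k is k'.+1 then stirling1 n k' else 0) - n%:Z * stirling1 n k.
Proof.
rewrite /stirling1 big_ord_recr /= mulrBr coefB coefMX coefMC mulrC.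
by case: k.
Qed.

Lemma stirling1_small n k : (n < k)%N -> stirling1 n k = 0.
Proof.
elim: n k => [|n IHn] [|k] // lt_nk.
  by rewrite /stirling1 big_ord0 coefC.
by rewrite stirling1S !IHn ?mulr0 ?subr0 //; apply: ltnW.
Qed.

(** Induction through the recurrence of [stirling1] avoids the substitution $x = y/\lambda$, so
    $\lambda = 0$ is covered as well, with $0^0 = 1$. *)
Lemma deg_ffact_stirling1 (R : realType) (lam y : R) n :
  deg_ffact lam y n =
    \sum_(l < n.+1) y ^+ l * lam ^+ (n - l) * (stirling1 n l)%:~R.
Proof.
elim: n => [|n IHn].
  rewrite /deg_ffact big_ord0 big_ord1 !expr0 !mul1r.
  by rewrite /stirling1 big_ord0 coefC.
rewrite /deg_ffact big_ord_recr /= -/(deg_ffact lam y n) IHn.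
under [RHS]eq_bigr do rewrite stirling1S rmorphB mulrBr.
(* The two sums come from the terms $y$ and $n\lambda$ of the new factor; the first has no term at
   $l = 0$. *)
rewrite sumrB [X in _ = X - _]big_ord_recl mulr0 add0r mulrBr; congr (_ - _).
  rewrite mulr_suml; apply: eq_bigr => l _.
  by rewrite lift0 subSS exprS; ring.
(* The top term $l = n + 1$ vanishes because $S_1(n, n+1) = 0$. *)
rewrite [RHS]big_ord_recr /= (@stirling1_small n n.+1) // !mulr0 addr0.
rewrite mulr_suml; apply: eq_bigr => l _.
have le_ln : (l <= n)%N by rewrite -ltnS.
by rewrite subSn // exprS rmorphM /=; ring.
Qed.

Section DegenerateStirling.
Variables (R : realType) (lam : R).

Lemma egf_coef_deg_exp y n : egf_coef (deg_exp lam y) n = deg_ffact lam y n.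
Proof.
by rewrite /egf_coef /= mulrC divfK // Num.Theory.pnatr_eq0 -lt0n fact_gt0.
Qed.

Lemma deg_exp_sub1_0 : (deg_exp lam 1 - 1) 0%N = 0.
Proof. by rewrite /= /deg_ffact big_ord0 divr1 subrr. Qed.

Lemma deg_stirling2_small n k : (n < k)%N -> deg_stirling2 lam n k = 0.
Proof.
move=> lt_nk; rewrite /deg_stirling2 /egf_coef coef_fpsCM.
by rewrite coef_fpsX_small ?mulr0 //; apply: deg_exp_sub1_0.
Qed.

Lemma ext_deg_stirling2_conv r n k :
  ext_deg_stirling2 lam r (n + r) (k + r) =
    \sum_(m < n.+1)
      deg_ffact lam r%:R (n - m) * deg_stirling2 lam m k * 'C(n, m)%:R.
Proof.
rewrite /ext_deg_stirling2 !addnK [fpsC _ * _]mulrC -mulrA egf_coefM.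
by apply: eq_bigr => m _; rewrite egf_coef_deg_exp.
Qed.

Lemma ext_deg_stirling2_stirling1 r n k : (k <= n)%N ->
  ext_deg_stirling2 lam r (n + r) (k + r) =
    \sum_(k <= m < n.+1) \sum_(0 <= l < (n - m).+1)
        r%:R ^+ l * lam ^+ (n - m - l) * (stirling1 (n - m) l)%:~R
        * deg_stirling2 lam m k * 'C(n, m)%:R.
Proof.
move=> le_kn; rewrite ext_deg_stirling2_conv.
rewrite -(big_mkord predT (fun m =>
  deg_ffact lam r%:R (n - m) * deg_stirling2 lam m k * 'C(n, m)%:R)).
(* The convolution runs over all $m \le n$; its part $m < k$ is zero since $S_{2,\lambda}(m,k) = 0$
   there. *)
rewrite (big_cat_nat (n := k)) //=; last exact: leqW.
rewrite big_nat_cond big1 ?add0r; last first.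
  by move=> m /andP[lt_mk _]; rewrite deg_stirling2_small ?mulr0 ?mul0r.
apply: eq_bigr => m _.
by rewrite deg_ffact_stirling1 !mulr_suml big_mkord.
Qed.

(** The bound [N] is independent of [n], so that all coefficients entering a product can be expanded
    over one common range of [k]; the added terms $n < k \le N$ vanish. *)
Lemma coef_fps_exp_XM (g : fps R) n N : g 0%N = 0 -> (n <= N)%N ->
  fps_exp (fpsC 'X * fps_map polyC g) n =
    \sum_(k < N.+1) (k`!%:R^-1 * (g ^+ k) n) *: 'X^k.
Proof.
move=> g0 le_nN; rewrite /=.
under eq_bigr do rewrite exprMn fpsC_exp -fps_map_exp coef_fpsCM /= mulrC
  mul_polyC scalerA.
rewrite (big_ord_widen N.+1 (fun k => (k`!%:R^-1 * (g ^+ k) n) *: 'X^k)) //.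
rewrite big_mkcond; apply: eq_bigr => k _; case: ltnP => // lt_nk.
by rewrite coef_fpsX_small // mulr0 scale0r.
Qed.

Lemma ext_deg_bell_stirling2 r n :
  ext_deg_bell lam r n =
    \sum_(k < n.+1) ext_deg_stirling2 lam r (n + r) (k + r) *: 'X^k.
Proof.
rewrite /ext_deg_bell /egf_coef coef_fpsM.
under eq_bigr do
  rewrite (coef_fps_exp_XM _ _ n deg_exp_sub1_0 (leq_subr _ _)) mulr_sumr.
(* With the range of [k] now fixed, the sums commute, and the inner one is the coefficient of a
   product over [R]. *)
rewrite exchange_big mulr_sumr; apply: eq_bigr => k _.
rewrite /ext_deg_stirling2 !addnK /egf_coef -mulrA coef_fpsCM coef_fpsM.
rewrite !mulr_sumr scaler_suml; apply: eq_bigr => i _.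
rewrite -polyC_natr !mul_polyC !scalerA; congr (_ *: _).
by ring.
Qed.

End DegenerateStirling.

Theorem theorem2p3 (R : realType) (lam : R) (r n : nat) :
  ext_deg_bell lam r n =
    \sum_(0 <= k < n.+1) ext_deg_stirling2 lam r (n + r) (k + r) *: 'X^k
  /\
  \sum_(0 <= k < n.+1) ext_deg_stirling2 lam r (n + r) (k + r) *: 'X^k =
    \sum_(0 <= k < n.+1)
      (\sum_(k <= m < n.+1) \sum_(0 <= l < (n - m).+1)
          r%:R ^+ l * lam ^+ (n - m - l) * (stirling1 (n - m) l)%:~R
          * deg_stirling2 lam m k * 'C(n, m)%:R) *: 'X^k.
Proof.
split; first by rewrite big_mkord ext_deg_bell_stirling2.
by apply: eq_big_nat => k /andP[_ le_kn]; rewrite ext_deg_stirling2_stirling1.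
Qed.
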